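(* Let $d\ge2$ be an integer and let $\mathcal{W}_{d,0}$ be the channel on $\mathbb{C}^d$ given by $\mathcal{W}_{d,0}(X)=\frac{1}{d-1}\left(\mathrm{Tr}(X)\mathbb{I}-X^T\right)$. Then $$\mathrm{cv}(\mathcal{W}_{d,0})=\frac{d}{d-1},\qquad \mathrm{cv}(\mathcal{W}_{d,0}\otimes\mathcal{W}_{d,0})=\frac{2d}{d-1}.$$ In particular $\mathrm{cv}(\mathcal{W}_{d,0})^2<\mathrm{cv}(\mathcal{W}_{d,0}\otimes\mathcal{W}_{d,0})$ whenever $d\ge3$.
   Context: $X^T$ is the transpose in a fixed orthonormal basis of $\mathbb{C}^d$. Communication value: for a classical channel with transition probabilities $P(y|x)$, $x\in[n]$, $y\in[n']$, put $\mathrm{cv}(\mathbf{P})=\sum_{y\in[n']}\max_{x\in[n]}P(y|x)$. For a quantum channel (CPTP map) $\mathcal{N}$, $\mathrm{cv}(\mathcal{N})$ is the supremum, over all $n,n'\in\mathbb{N}$, all density operators $\rho_1,\dots,\rho_n$ on the input space and all POVMs $\{\Pi_y\}_{y=1}^{n'}$ on the output space, of $\mathrm{cv}(\mathbf{P})$ with $P(y|x)=\mathrm{Tr}[\Pi_y\mathcal{N}(\rho_x)]$. For a tensor product channel, arbitrary (possibly entangled) states and joint POVMs on the composite input and output spaces are allowed. *)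

(* Defs.v *)
From HB Require Import structures.
From mathcomp Require Import all_boot all_order all_algebra spectral sesquilinear.
From mathcomp Require Import classical_sets reals constructive_ereal ereal.
From mathcomp Require Import complex mxtens ring.
Set Implicit Arguments.
Unset Strict Implicit.
Unset Printing Implicit Defensive.
Import Order.TTheory GRing.Theory Num.Theory.
Local Open Scope ring_scope.
Local Open Scope complex_scope.
Local Open Scope sesquilinear_scope.

Section Quantum.
Variable R : realType.
Local Notation C := (R[i]).

(* In R[i], 0 <= z means that z is real and nonnegative, so this makes A
   Hermitian. *)
Definition psdmx n (A : 'M[C]_n) : Prop :=
  forall v : 'cV[C]_n, 0 <= (v^t* *m A *m v) 0 0.

Definition density n (rho : 'M[C]_n) : Prop := psdmx rho /\ \tr rho = 1.

Definition povm n m (Pi : 'I_m -> 'M[C]_n) : Prop :=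
  (forall y, psdmx (Pi y)) /\ \sum_y Pi y = 1%:M.

(* The linear extension of A *t B |-> N A *t M B (see tens_map_tens);
   C^p (x) C^q is C^(p * q), as for *t. *)
Definition tens_map p p' q q' (N : 'M[C]_p -> 'M[C]_p')
    (M : 'M[C]_q -> 'M[C]_q') (X : 'M[C]_(p * q)) : 'M[C]_(p' * q') :=
  \sum_(i < p) \sum_(j < p) \sum_(k < q) \sum_(l < q)
    X (mxtens_index (i, k)) (mxtens_index (j, l)) *:
      (N (delta_mx i j) *t M (delta_mx k l)).

Record channel p p' (N : 'M[C]_p -> 'M[C]_p') : Prop := Channel {
  channel_linear : linear N ;
  channel_cp : forall k (X : 'M[C]_(p * k)),
    psdmx X -> psdmx (tens_map N (@idfun 'M[C]_k) X) ;
  channel_tp : forall X, \tr (N X) = \tr X }.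

(* The input alphabet has n.+1 letters: the maximum is over a nonempty set and
   needs no default value.  P x y is the probability P(y|x). *)
Definition classical_cv n m (P : 'I_n.+1 -> 'I_m -> R) : R :=
  \sum_(y < m) \big[Num.max/P ord0 y]_(x < n.+1) P x y.

Definition induced_law p p' (N : 'M[C]_p -> 'M[C]_p') n m
    (rho : 'I_n.+1 -> 'M[C]_p) (Pi : 'I_m -> 'M[C]_p') x y : R :=
  complex.Re (\tr (Pi y *m N (rho x))).

Definition cv p p' (N : 'M[C]_p -> 'M[C]_p') : \bar R :=
  ereal_sup [set c | exists n m (rho : 'I_n.+1 -> 'M[C]_p)
                       (Pi : 'I_m -> 'M[C]_p'),
    [/\ forall x, density (rho x), povm Pi &
        c = (classical_cv (induced_law N rho Pi))%:E]]%classic.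

Definition werner0 d (X : 'M[C]_d) : 'M[C]_d :=
  (d%:R - 1)^-1 *: ((\tr X) *: 1%:M - X^T).

Lemma tensmx_suml (I : Type) (r : seq I) m n p q (F : I -> 'M[C]_(m, n))
  (B : 'M[C]_(p, q)) : (\sum_(i <- r) F i) *t B = \sum_(i <- r) F i *t B.
Proof.
by apply/matrixP=> i j; rewrite summxE !mxE summxE mulr_suml;
   apply: eq_bigr => k _; rewrite !mxE.
Qed.

Lemma tensmx_sumr (I : Type) (r : seq I) m n p q (A : 'M[C]_(m, n))
  (F : I -> 'M[C]_(p, q)) : A *t (\sum_(i <- r) F i) = \sum_(i <- r) A *t F i.
Proof.
by apply/matrixP=> i j; rewrite summxE !mxE summxE mulr_sumr;
   apply: eq_bigr => k _; rewrite !mxE.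
Qed.

Lemma tensmxZ m n p q a b (A : 'M[C]_(m, n)) (B : 'M[C]_(p, q)) :
  (a *: A) *t (b *: B) = (a * b) *: (A *t B).
Proof. by apply/matrixP=> i j; rewrite !mxE mulrACA. Qed.

Lemma tens_map_tens p p' q q' (N : {linear 'M[C]_p -> 'M[C]_p'})
    (M : {linear 'M[C]_q -> 'M[C]_q'}) A B :
  tens_map N M (A *t B) = N A *t M B.
Proof.
rewrite {2}(matrix_sum_delta A) {2}(matrix_sum_delta B) !linear_sum tensmx_suml.
apply: eq_bigr => i _; rewrite linear_sum tensmx_suml.
apply: eq_bigr => j _; rewrite tensmx_sumr.
apply: eq_bigr => k _; rewrite linear_sum tensmx_sumr.
by apply: eq_bigr => l _; rewrite !linearZ /= tensmxZ tensmxE.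
Qed.

Lemma tens_map_id p q (X : 'M[C]_(p * q)) : tens_map idfun idfun X = X.
Proof.
apply/matrixP=> a b; case: (mxtens_indexP a) => i k; case: (mxtens_indexP b) => j l.
rewrite summxE (bigD1 i) //= [X in _ + X]big1 ?addr0; last first.
  move=> i' ni; rewrite summxE big1 // => ? _; rewrite summxE big1 // => ? _.
  rewrite summxE big1 // => ? _; rewrite mxE tensmxE !mxE.
  by rewrite eq_sym (negPf ni) mul0r mulr0.
rewrite summxE (bigD1 j) //= [X in _ + X]big1 ?addr0; last first.
  move=> j' nj; rewrite summxE big1 // => ? _; rewrite summxE big1 // => ? _.
  by rewrite mxE tensmxE !mxE [j == _]eq_sym (negPf nj) andbF mul0r mulr0.
rewrite summxE (bigD1 k) //= [X in _ + X]big1 ?addr0; last first.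
  move=> k' nk; rewrite summxE big1 // => ? _.
  by rewrite mxE tensmxE !mxE [k == _]eq_sym (negPf nk) !mulr0.
rewrite summxE (bigD1 l) //= [X in _ + X]big1 ?addr0; last first.
  move=> l' nl.
  by rewrite mxE tensmxE !mxE [l == _]eq_sym (negPf nl) andbF !mulr0.
by rewrite mxE tensmxE !mxE !eqxx !mulr1.
Qed.

Lemma psdmx_sum (I : finType) n (F : I -> 'M[C]_n) :
  (forall i, psdmx (F i)) -> psdmx (\sum_i F i).
Proof.
move=> h v; rewrite mulmx_sumr mulmx_suml summxE.
by apply: sumr_ge0 => i _; apply: h.
Qed.

Lemma psdmxZ n a (A : 'M[C]_n) : 0 <= a -> psdmx A -> psdmx (a *: A).
Proof.
move=> a0 h v; rewrite -scalemxAr -scalemxAl mxE.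
by apply: mulr_ge0 => //; apply: h.
Qed.

Lemma psdmx_conj m n (K : 'M[C]_(m, n)) (A : 'M[C]_n) :
  psdmx A -> psdmx (K *m A *m K^t*).
Proof.
move=> h v; have := h (K^t* *m v).
by rewrite trmx_mul map_mxM trmxCK !mulmxA.
Qed.

Lemma werner0_linear d : linear (@werner0 d).
Proof.
move=> a X Y; rewrite /werner0 mxtraceD mxtraceZ linearP /=.
by apply/matrixP=> i j; rewrite !mxE; ring.
Qed.

Definition werner_kraus d (ij : 'I_d * 'I_d) : 'M[C]_d :=
  delta_mx ij.1 ij.2 - delta_mx ij.2 ij.1.

Lemma delta_sandwich d (X : 'M[C]_d) (a b c e : 'I_d) :
  delta_mx a b *m X *m delta_mx c e = X b c *: delta_mx a e.
Proof.
apply/matrixP=> i j; rewrite !mxE (bigD1 c) //= big1 ?addr0; last first.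
  by move=> k nk; rewrite !mxE (negPf nk) mulr0.
rewrite !mxE eqxx /= (bigD1 b) //= big1 ?addr0; last first.
  by move=> k nk; rewrite !mxE (negPf nk) andbF mul0r.
by rewrite !mxE eqxx andbT; case: (i == a); case: (j == e);
   rewrite ?(mul0r, mul1r, mulr0, mulr1).
Qed.

Lemma werner0_kraus d (X : 'M[C]_d) :
  werner0 X = ((d%:R - 1)^-1 / 2) *:
    \sum_ij werner_kraus ij *m X *m (werner_kraus ij)^T.
Proof.
have scal : \sum_(a < d) \sum_(b < d) X b b *: (delta_mx a a : 'M[C]_d) = \tr X *: 1%:M.
  under eq_bigr do rewrite -scaler_suml.
  by rewrite -scaler_sumr [in RHS]mx1_sum_delta.
have transp : \sum_(a < d) \sum_(b < d) X a b *: (delta_mx b a : 'M[C]_d) = X^T.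
  rewrite [in RHS](matrix_sum_delta X) !linear_sum; apply: eq_bigr => a _.
  rewrite linear_sum; apply: eq_bigr => b _.
  by rewrite linearZ /= trmx_delta.
rewrite -(pair_bigA _ (fun a b : 'I_d =>
   werner_kraus (a, b) *m X *m (werner_kraus (a, b))^T)) /=.
have -> : \sum_(a < d) \sum_(b < d)
     werner_kraus (a, b) *m X *m (werner_kraus (a, b))^T =
   2 *: (\tr X *: 1%:M - X^T).
  rewrite scalerBr !scaler_nat !mulr2n -{1}scal -{1}transp.
  rewrite -scal -transp [X in _ = X + _ - _]exchange_big.
  rewrite [X in _ = _ - (X + _)]exchange_big /= -!big_split -sumrB /=.
  apply: eq_bigr => a _; rewrite -!big_split -sumrB /=; apply: eq_bigr => b _.
  rewrite /werner_kraus /= linearB /= !trmx_delta mulmxBl mulmxBr !mulmxBl.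
  rewrite !delta_sandwich.
  by apply/matrixP=> i j; rewrite !mxE; ring.
by rewrite scalerA mulfVK // pnatr_eq0.
Qed.

Lemma werner_kraus_real d ij : (@werner_kraus d ij)^t* = (werner_kraus ij)^T.
Proof.
by rewrite /werner_kraus; apply/matrixP=> i j; rewrite !mxE rmorphB !rmorph_nat.
Qed.

Lemma kraus_cp p p' k (I : finType) (K : I -> 'M[C]_(p', p)) a
    (N : 'M[C]_p -> 'M[C]_p') (X : 'M[C]_(p * k)) :
    0 <= a -> (forall Y, N Y = a *: \sum_i K i *m Y *m (K i)^t*) ->
  psdmx X -> psdmx (tens_map N (@idfun 'M[C]_k) X).
Proof.
move=> a0 defN X0.
pose L i : 'M[C]_(p' * k, p * k) := K i *t (1%:M : 'M[C]_k).
suff -> : tens_map N (@idfun 'M[C]_k) X = a *: \sum_i L i *m X *m (L i)^t*.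
  by apply: psdmxZ => //; apply: psdmx_sum => i; apply: psdmx_conj.
under [in RHS]eq_bigr => i _.
  rewrite -[X in L i *m X]tens_map_id mulmx_sumr mulmx_suml.
  under eq_bigr => e _.
    rewrite mulmx_sumr mulmx_suml.
    under eq_bigr => f _.
      rewrite mulmx_sumr mulmx_suml.
      under eq_bigr => g _.
        rewrite mulmx_sumr mulmx_suml.
        under eq_bigr => h _.
          rewrite -scalemxAr -scalemxAl trmx_tens map_mxT trmx1 map_mx1.
          rewrite !tensmx_mul mul1mx mulmx1.
          over.
        over.
      over.
    over.
  over.
rewrite [in RHS]exchange_big scaler_sumr; apply: eq_bigr => e _.
rewrite [in RHS]exchange_big scaler_sumr; apply: eq_bigr => f _.
rewrite [in RHS]exchange_big scaler_sumr; apply: eq_bigr => g _.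
rewrite [in RHS]exchange_big scaler_sumr; apply: eq_bigr => h _ /=.
rewrite -scaler_sumr -tensmx_suml defN -[delta_mx g h in LHS]scale1r.
by rewrite tensmxZ mulr1 !scalerA mulrC.
Qed.

Lemma werner0_channel d : (1 < d)%N -> channel (@werner0 d).
Proof.
move=> d1; have d10 : 0 < d%:R - 1 :> C by rewrite subr_gt0 ltr1n.
split; first exact: werner0_linear.
  move=> k X; apply: (@kraus_cp _ _ _ _ (@werner_kraus d) ((d%:R - 1)^-1 / 2)).
    by rewrite divr_ge0 ?invr_ge0 ?ler0n ?ltW.
  move=> Y; rewrite werner0_kraus; congr (_ *: _).
  by apply: eq_bigr => ij _; rewrite werner_kraus_real.
move=> X; rewrite /werner0 linearZ /= linearB /= linearZ /= mxtrace1 mxtrace_tr.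
have -> : \tr X * d%:R - \tr X = (d%:R - 1) * \tr X by ring.
rewrite mulrA mulVf ?mul1r //.
by rewrite gt_eqF.
Qed.

End Quantum.

(* Main.v *)
From HB Require Import structures.
Require Import Defs.
From mathcomp Require Import all_boot all_order all_algebra.
From mathcomp Require Import reals constructive_ereal.
From mathcomp Require Import spectral sesquilinear classical_sets ereal.
From mathcomp Require Import complex mxtens ring lra.
Set Implicit Arguments.
Unset Strict Implicit.
Unset Printing Implicit Defensive.
Import Order.TTheory GRing.Theory Num.Theory.
Local Open Scope ring_scope.
Local Open Scope sesquilinear_scope.

(** A uniform bound b on the expectation of N(rho) in unit vectors gives cv(N) <= b p',
    where p' is the output dimension, because the POVM sums to the identity.  By the
    spectral theorem it is enough to treat pure states.

    One copy: the expectation in w of the image of the state v is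
      (|v|^2 |w|^2 - |v^T w|^2) / (d - 1) <= |v|^2 |w|^2 / (d - 1).

    Two copies: reading v and w as d x d matrices M and N, the expectation is
      (|M|^2 |N|^2 - |N M^T|^2 - |N^T M|^2 + |tr (N M^T)|^2) / (d - 1)^2
    with Frobenius norms.  Cauchy-Schwarz gives |G|^2 >= |tr G|^2 / d for
    G = N M^T, N^T M and |tr (N M^T)|^2 <= |M|^2 |N|^2, hence the bound
    (2 - 2 / d) |M|^2 |N|^2 / (d - 1)^2.

    Equality holds when N is the conjugate of M and M is proportional to a unitary,
    i.e. for maximally entangled states.  The matrices used are
    diag(signs) times a cyclic shift: their rank-one projectors, summed over all signs
    and shifts, give a multiple of the identity, and all of
    them are real. *)

(** * Positive semidefinite matrices: Hermitian symmetry and rank-one decomposition *)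

Lemma eq_conj_of_real (C : numClosedFieldType) (x y : C) :
  x + y \is Num.real -> 'i * x - 'i * y \is Num.real -> x = y^*.
Proof.
move=> /CrealP; rewrite rmorphD /= => e1.
move=> /CrealP; rewrite rmorphB !rmorphM /= conjCi => e2.
have {}e2 : y^* - x^* = x - y.
  by apply: (mulfI (neq0Ci C)); rewrite mulrBr [RHS]mulrBr -e2; ring.
apply: (@mulfI _ 2); rewrite ?pnatr_eq0 //.
have -> : 2 * x = (x + y) + (x - y) by ring.
rewrite -e1 -e2; ring.
Qed.

Section CommunicationValue.
Variable R : realType.
Local Notation C := (complex R).

Lemma form_delta n (A : 'M[C]_n) (i j : 'I_n) :
  ((delta_mx i 0 : 'cV[C]_n)^t* *m A *m (delta_mx j 0 : 'cV[C]_n)) 0 0 = A i j.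
Proof.
rewrite trmx_delta map_delta_mx -rowE mxE (bigD1 j) //= big1 ?addr0.
  by rewrite !mxE !eqxx mulr1.
by move=> k nk; rewrite !mxE (negPf nk) mulr0.
Qed.

(** Polarization: the form is real on the diagonal, and its values at u + v and u + 'i v give the
    two reality hypotheses of [eq_conj_of_real]. *)
Lemma psdmx_hermsym n (A : 'M[C]_n) : psdmx A -> A \is hermsymmx.
Proof.
move=> A0; pose b (u v : 'cV[C]_n) := (u^t* *m A *m v) 0 0.
have bDl u u' v : b (u + u') v = b u v + b u' v.
  by rewrite /b linearD /= map_mxD !mulmxDl mxE.
have bDr u v v' : b u (v + v') = b u v + b u v'.
  by rewrite /b mulmxDr mxE.
have bZl a u v : b (a *: u) v = a^* * b u v.
  by rewrite /b linearZ /= map_mxZ -!scalemxAl mxE.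
have bZr a u v : b u (a *: v) = a * b u v.
  by rewrite /b -scalemxAr mxE.
have bR u : b u u \is Num.real by apply/ger0_real/A0.
apply/is_hermitianmxP; rewrite expr0 scale1r; apply/matrixP=> i j.
rewrite !mxE -(form_delta A i j) -(form_delta A j i) -!/(b _ _).
move: (delta_mx i 0) (delta_mx j 0) => u v.
apply: eq_conj_of_real.
  have -> : b u v + b v u = b (u + v) (u + v) - b u u - b v v.
    by rewrite !(bDl, bDr); ring.
  by rewrite !rpredB.
have -> : 'i * b u v - 'i * b v u = b (u + 'i *: v) (u + 'i *: v) - b u u - b v v.
  have i2 : 'i * 'i = -1 :> C by rewrite -expr2 sqrCi.
  rewrite !(bDl, bDr, bZl, bZr) conjCi.
  by ring: i2.
by rewrite !rpredB.
Qed.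

(** Spectral theorem, each eigenvector being scaled by the square root of its nonnegative
    eigenvalue. *)
Lemma psdmx_rank1_sum n (A : 'M[C]_n) : psdmx A ->
  exists v : 'I_n -> 'cV[C]_n, A = \sum_i v i *m (v i)^t*.
Proof.
move=> A0; have /hermitian_normalmx/orthomx_spectralP := psdmx_hermsym A0.
set P := spectralmx A; set sp := spectral_diag A => defA.
have Pu : P \is unitarymx by apply: spectral_unitarymx.
rewrite invmx_unitary // in defA.
have sp_ge0 i : 0 <= sp 0 i.
  have := psdmx_conj P A0 (delta_mx i 0).
  rewrite form_delta defA !mulmxA mulmxtVK // (unitarymxP Pu) mul1mx.
  by rewrite !mxE eqxx.
exists (fun i => sqrtC (sp 0 i) *: (row i P)^t*).
rewrite [LHS]defA; apply/matrixP=> j k.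
rewrite mul_mx_diag summxE mxE; apply: eq_bigr => i _.
rewrite !mxE big_ord1 !mxE !rmorphM /= conjCK.
have -> : (sqrtC (sp 0 i))^* = sqrtC (sp 0 i).
  by apply/CrealP/ger0_real; rewrite sqrtC_ge0.
by rewrite mulrACA -expr2 sqrtCK mulrCA mulrA.
Qed.

Lemma mxtrace_rank1 n (w : 'cV[C]_n) (X : 'M[C]_n) :
  \tr (w *m w^t* *m X) = (w^t* *m X *m w) 0 0.
Proof. by rewrite -mulmxA mxtrace_mulC trace_mx11. Qed.

Lemma Re_sum (I : finType) (F : I -> C) :
  complex.Re (\sum_i F i) = \sum_i complex.Re (F i).
Proof. by apply: (big_morph (@complex.Re R)) => // -[a b] [c d]. Qed.

Lemma sum_enum_val (V : nmodType) (T : finType) (F : T -> V) :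
  \sum_(y < #|T|) F (enum_val y) = \sum_t F t.
Proof. by rewrite -(big_enum_val F); apply: eq_bigl. Qed.

(** * Upper and lower bounds on the communication value of a linear map *)

Section Bounds.
Variables (p p' : nat) (N : {linear 'M[C]_p -> 'M[C]_p'}).

(** Both sides are additive in [rho] and in [Pi], so the rank-one decompositions reduce the claim to
    the hypothesis. *)
Lemma mxtrace_psdmx_le (b : R) rho Pi :
    (forall (v : 'cV[C]_p) (w : 'cV[C]_p'), (w^t* *m N (v *m v^t*) *m w) 0 0
       <= (b%:C)%C * (\tr (v *m v^t*) * \tr (w *m w^t*))) ->
  psdmx rho -> psdmx Pi ->
  \tr (Pi *m N rho) <= (b%:C)%C * (\tr rho * \tr Pi).
Proof.
move=> leN /psdmx_rank1_sum[v ->] /psdmx_rank1_sum[w ->].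
rewrite !linear_sum /= mulr_suml mulr_sumr; apply: ler_sum => i _.
rewrite mulmx_suml linear_sum !mulr_sumr; apply: ler_sum => j _.
by rewrite /= mxtrace_rank1; apply: leN.
Qed.

Lemma cv_le (b : R) :
    (forall (v : 'cV[C]_p) (w : 'cV[C]_p'), (w^t* *m N (v *m v^t*) *m w) 0 0
       <= (b%:C)%C * (\tr (v *m v^t*) * \tr (w *m w^t*))) ->
  (cv N <= (b * p'%:R)%:E)%E.
Proof.
move=> leN; apply: ge_ereal_sup => _ [n] [m] [rho] [Pi] [rho1 [Pi0 Pi1] ->].
rewrite lee_fin /classical_cv.
have le_tr x y : induced_law N rho Pi x y <= b * complex.Re (\tr (Pi y)).
  have [rho0 tr_rho] := rho1 x.
  have := mxtrace_psdmx_le leN rho0 (Pi0 y).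
  rewrite tr_rho mul1r lecE => /andP[_] /le_trans; apply.
  by case: (\tr _) => a c /=; rewrite mul0r subr0.
have -> : p'%:R = \sum_y complex.Re (\tr (Pi y)) :> R.
  by rewrite -Re_sum -linear_sum Pi1 /= mxtrace1 -(rmorph_nat (real_complex R)).
rewrite mulr_sumr; apply: ler_sum => y _.
(* The default of the maximum is the probability of letter 0, so the same bound covers it. *)
by apply: bigmax_le => [|x _]; apply: le_tr.
Qed.

(** Letters and outcomes share the index type: the maximum for outcome t is at least the probability
    of t when letter t is sent. *)
Lemma cv_ge (T : finType) (t0 : T) (rho : T -> 'M[C]_p) (Pi : T -> 'M[C]_p') :
    (forall t, density (rho t)) -> (forall t, psdmx (Pi t)) ->
    \sum_t Pi t = 1%:M ->
  ((\sum_t complex.Re (\tr (Pi t *m N (rho t))))%:E <= cv N)%E.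
Proof.
move=> rho1 Pi0 Pi1.
(* The alphabet must have successor size; [t0] shows that [T] is nonempty, so its size is #|T|. *)
pose rho' (x : 'I_(#|T|.-1.+1)) := rho (nth t0 (enum T) x).
pose Pi' (y : 'I_#|T|) := Pi (enum_val y).
apply: (@le_trans _ _ (classical_cv (induced_law N rho' Pi'))%:E); last first.
  apply: ereal_sup_ubound; exists #|T|.-1, #|T|, rho', Pi'; split=> // [x|].
    exact: rho1.
  split=> [y|]; first exact: Pi0.
  by rewrite -Pi1 -(sum_enum_val Pi).
rewrite lee_fin /classical_cv -sum_enum_val; apply: ler_sum => y _.
have T0 : (0 < #|T|)%N by apply/card_gt0P; exists t0.
have lt_y : (y < #|T|.-1.+1)%N by rewrite prednK.
apply: le_trans (le_bigmax _ _ (inord y)).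
by rewrite /induced_law /rho' /Pi' inordK // -enum_val_nth.
Qed.

End Bounds.

(** * Frobenius norm and Cauchy-Schwarz inequalities *)

Definition sqnorm m n (G : 'M[C]_(m, n)) : C := \sum_i \sum_j `|G i j| ^+ 2.

Lemma sqnorm_ge0 m n (G : 'M[C]_(m, n)) : 0 <= sqnorm G.
Proof. by apply: sumr_ge0 => i _; apply: sumr_ge0 => j _; rewrite exprn_ge0. Qed.

Lemma mxtrace_mulmx_tr m n (G H : 'M[C]_(m, n)) :
  \tr (G *m H^T) = \sum_i \sum_j G i j * H i j.
Proof.
by apply: eq_bigr => i _; rewrite mxE; apply: eq_bigr => j _; rewrite mxE.
Qed.

Lemma mxtrace_trmul m n (G H : 'M[C]_(m, n)) : \tr (G^T *m H) = \tr (G *m H^T).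
Proof. by rewrite -mxtrace_tr trmx_mul trmxK mxtrace_mulC. Qed.

Lemma sqnormE m n (G : 'M[C]_(m, n)) : sqnorm G = \tr (G *m G^t*).
Proof.
rewrite -map_trmx mxtrace_mulmx_tr; apply: eq_bigr => i _; apply: eq_bigr => j _.
by rewrite normCK mxE.
Qed.

(** Cauchy-Schwarz for G and the entrywise conjugate of H: the two conjugations cancel and leave the
    bilinear pairing. *)
Lemma mxtrace_mulmx_tr_le m n (G H : 'M[C]_(m, n)) :
  `|\tr (G *m H^T)| ^+ 2 <= sqnorm G * sqnorm H.
Proof.
have dotE (A B : 'M[C]_(m, n)) :
    dotmx (mxvec A) (mxvec B) = \sum_i \sum_j A i j * (B i j)^*.
  rewrite dotmxE mxE (reindex _ (curry_mxvec_bij _ _)) /= pair_bigA /=.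
  by apply: eq_bigr => -[i j] _; rewrite !mxE !mxvecE.
have CS (u v : 'rV[C]_(m * n)) : `|dotmx u v| ^+ 2 <= dotmx u u * dotmx v v.
  by have [] := CauchySchwarz (@dotmx C (m * n)) u v.
have := CS (mxvec G) (mxvec (map_mx Num.conj H)).
rewrite !dotE mxtrace_mulmx_tr.
under eq_bigr do under eq_bigr do rewrite mxE conjCK.
under [X in _ <= X * _]eq_bigr do under eq_bigr do rewrite -normCK.
by under [X in _ <= _ * X]eq_bigr do under eq_bigr do rewrite mxE -normCK norm_conjC.
Qed.

Lemma mxtrace_sqr_le n (G : 'M[C]_n) : `|\tr G| ^+ 2 <= n%:R * sqnorm G.
Proof.
have := mxtrace_mulmx_tr_le G 1%:M; rewrite trmx1 mulmx1 mulrC.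
by rewrite [sqnorm 1%:M]sqnormE trmx1 map_mx1 mulmx1 mxtrace1.
Qed.

(** * Expectations of one and two copies in pure states *)

Lemma sum_mxtens (V : nmodType) p q (F : 'I_(p * q) -> V) :
  \sum_x F x = \sum_i \sum_j F (mxtens_index (i, j)).
Proof.
rewrite pair_bigA (reindex (@mxtens_index p q)) /=.
  by apply: eq_bigr => -[].
exists (@mxtens_unindex p q) => x _; [exact: mxtens_indexK|exact: mxtens_unindexK].
Qed.

Lemma tens_map_linear p p' q q' (N : 'M[C]_p -> 'M[C]_p')
  (M : 'M[C]_q -> 'M[C]_q') : linear (tens_map N M).
Proof.
move=> a X Y; rewrite /tens_map scaler_sumr -big_split; apply: eq_bigr => i _.
rewrite scaler_sumr -big_split; apply: eq_bigr => j _.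
rewrite scaler_sumr -big_split; apply: eq_bigr => k _.
rewrite scaler_sumr -big_split; apply: eq_bigr => l _ /=.
by rewrite !mxE scalerDl scalerA.
Qed.

HB.instance Definition _ p p' q q' N M :=
  GRing.isLinear.Build C 'M[C]_(p * q) 'M[C]_(p' * q') _ (@tens_map R p p' q q' N M)
    (@tens_map_linear p p' q q' N M).

HB.instance Definition _ d :=
  GRing.isLinear.Build C 'M[C]_d 'M[C]_d _ (@werner0 R d) (@werner0_linear R d).

(** The transpose of v v^* is conj(v) v^T, whose expectation in w is |v^T w|^2, and v^T w = tr (v
    w^T). *)
Lemma werner0_form d (v w : 'cV[C]_d) :
  (w^t* *m werner0 (v *m v^t*) *m w) 0 0 =
    (d%:R - 1)^-1 * (\tr (v *m v^t*) * \tr (w *m w^t*) - `|\tr (v *m w^T)| ^+ 2).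
Proof.
rewrite /werner0 -scalemxAr -scalemxAl mulmxBr mulmxBl -scalemxAr mulmx1 -scalemxAl.
rewrite mxE [X in _ * X]mxE [X in _ * (X + _)]mxE [X in _ * (_ + X)]mxE.
congr (_ * (_ * _ - _)); first by rewrite mxtrace_mulC trace_mx11.
rewrite trmx_mul map_trmx trmxK !mulmxA -[_ *m v^T *m w]mulmxA mxE big_ord1 mxtrace_mulC.
rewrite trace_mx11 normCK mulrC !mxE rmorph_sum; congr (_ * _).
  by apply: eq_bigr => i _; rewrite !mxE mulrC.
by apply: eq_bigr => i _; rewrite !mxE rmorphM.
Qed.

Definition unvec p q (v : 'cV[C]_(p * q)) : 'M[C]_(p, q) :=
  \matrix_(i, j) v (mxtens_index (i, j)) 0.

Lemma sqnorm_unvec p q (v : 'cV[C]_(p * q)) :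
  sqnorm (unvec v) = \tr (v *m v^t*).
Proof.
rewrite mxtrace_mulC trace_mx11 mxE sum_mxtens.
apply: eq_bigr => i _; apply: eq_bigr => j _.
by rewrite !mxE normCK mulrC.
Qed.

Lemma linear_mx_entry p p' (N : {linear 'M[C]_p -> 'M[C]_p'})
    (f : 'I_p -> 'I_p -> C) a b :
  \sum_i \sum_j f i j * N (delta_mx i j) a b = N (\matrix_(i, j) f i j) a b.
Proof.
rewrite [in RHS](matrix_sum_delta (\matrix_(i, j) f i j)) linear_sum summxE.
apply: eq_bigr => i _; rewrite linear_sum summxE; apply: eq_bigr => j _.
by rewrite linearZ !mxE.
Qed.

(** The factors act in turn: [M] on each block with fixed first-factor indices i, j, then [N] on the
    matrix of the (b, b') entries obtained. *)
Lemma tens_map_entry p p' q q' (N : {linear 'M[C]_p -> 'M[C]_p'})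
    (M : {linear 'M[C]_q -> 'M[C]_q'}) X a b a' b' :
  tens_map N M X (mxtens_index (a, b)) (mxtens_index (a', b')) =
  N (\matrix_(i, j) M (\matrix_(k, l)
       X (mxtens_index (i, k)) (mxtens_index (j, l))) b b') a a'.
Proof.
rewrite -linear_mx_entry summxE; apply: eq_bigr => i _.
rewrite summxE; apply: eq_bigr => j _.
rewrite -linear_mx_entry mulr_suml summxE; apply: eq_bigr => k _.
rewrite mulr_suml summxE; apply: eq_bigr => l _.
by rewrite mxE tensmxE mulrA mulrAC.
Qed.

Lemma werner0E d (Y : 'M[C]_d) a b :
  werner0 Y a b = (d%:R - 1)^-1 * ((a == b)%:R * \tr Y - Y b a).
Proof. by rewrite !mxE [\tr Y * _]mulrC. Qed.

Lemma sum_delta (V : pzSemiRingType) (I : finType) (i : I) (F : I -> V) :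
  \sum_j (i == j)%:R * F j = F i.
Proof.
rewrite (bigD1 i) //= eqxx mul1r big1 ?addr0 // => j nj.
by rewrite eq_sym (negPf nj) mul0r.
Qed.

Lemma form_mxtens p q (X : 'M[C]_(p * q)) (w : 'cV[C]_(p * q)) :
  (w^t* *m X *m w) 0 0 = \sum_a \sum_b \sum_a' \sum_b'
    (unvec w a b)^* * unvec w a' b' * X (mxtens_index (a, b)) (mxtens_index (a', b')).
Proof.
rewrite -mulmxA mxE sum_mxtens; apply: eq_bigr => a _; apply: eq_bigr => b _.
rewrite [X in _ * X]mxE sum_mxtens mulr_sumr; apply: eq_bigr => a' _; rewrite mulr_sumr.
by apply: eq_bigr => b' _; rewrite !mxE; ring.
Qed.

(** Expanding Tr I - T on each factor, T the transposition, gives four terms: the full trace, the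
    transposed reduced states of the second and first factors, and the full transpose. *)
Lemma werner0_tens_rank1E d (v : 'cV[C]_(d * d)) a b a' b' :
  tens_map (@werner0 R d) (@werner0 R d) (v *m v^t*)
      (mxtens_index (a, b)) (mxtens_index (a', b')) =
  (d%:R - 1)^-1 ^+ 2 *
    ((a == a')%:R * ((b == b')%:R * sqnorm (unvec v)
       - \sum_i unvec v i b' * (unvec v i b)^*)
     - ((b == b')%:R * (\sum_k unvec v a' k * (unvec v a k)^*)
       - unvec v a' b' * (unvec v a b)^*)).
Proof.
have vvE i k j l : (v *m v^t*) (mxtens_index (i, k)) (mxtens_index (j, l)) =
    unvec v i k * (unvec v j l)^*.
  by rewrite mxE big_ord1 !mxE.
rewrite tens_map_entry werner0E expr2 -mulrA; congr (_ * _).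
rewrite mxE werner0E mxE vvE [RHS]mulrBr; congr (_ - _ * (_ * _ - _)); last first.
  by apply: eq_bigr => k _; rewrite mxE vvE.
rewrite [RHS]mulrCA; congr (_ * _); rewrite mulrBr mulrCA !mulr_sumr -sumrB.
apply: eq_bigr => i _; rewrite mxE werner0E mxE vvE mulrBr mulrCA.
congr (_ * (_ * _) - _).
by apply: eq_bigr => k _; rewrite mxE vvE normCK.
Qed.

Lemma werner0_tens_form d (v w : 'cV[C]_(d * d))
    (M := unvec v) (N := unvec w) :
  (w^t* *m tens_map (@werner0 R d) (@werner0 R d) (v *m v^t*) *m w) 0 0 =
  (d%:R - 1)^-1 ^+ 2 *
    (sqnorm M * sqnorm N - sqnorm (N *m M^T) - sqnorm (N^T *m M)
     + `|\tr (N *m M^T)| ^+ 2).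
Proof.
rewrite form_mxtens -/N.
(* The four terms are separated so that each Kronecker delta collapses one sum; the remaining sums
   factor as squared moduli of entries of N M^T, of entries of N^T M, and of the trace. *)
transitivity ((d%:R - 1)^-1 ^+ 2 * \sum_a \sum_b \sum_a' \sum_b'
   ((a == a')%:R * ((b == b')%:R * ((N a b)^* * N a' b' * sqnorm M))
    - (a == a')%:R * ((N a b)^* * N a' b' * \sum_i M i b' * (M i b)^*)
    - (b == b')%:R * ((N a b)^* * N a' b' * \sum_k M a' k * (M a k)^*)
    + (N a' b' * M a' b') * (N a b * M a b)^*)).
  rewrite mulr_sumr; apply: eq_bigr => a _; rewrite mulr_sumr; apply: eq_bigr => b _.
  rewrite mulr_sumr; apply: eq_bigr => a' _; rewrite mulr_sumr; apply: eq_bigr => b' _.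
  by rewrite werner0_tens_rank1E rmorphM -/M /=; ring.
congr (_ * _).
under eq_bigr do under eq_bigr do under eq_bigr do rewrite big_split 2!sumrB /=.
under eq_bigr do under eq_bigr do rewrite big_split 2!sumrB /=.
under eq_bigr do rewrite big_split 2!sumrB /=.
rewrite big_split 2!sumrB /=; congr (_ - _ - _ + _).
- rewrite mulr_sumr; apply: eq_bigr => a _; rewrite mulr_sumr; apply: eq_bigr => b _.
  under eq_bigr do rewrite -mulr_sumr.
  by rewrite sum_delta sum_delta normCK; ring.
- apply: eq_bigr => a _.
  under eq_bigr do (under eq_bigr do rewrite -mulr_sumr); rewrite /=.
  under eq_bigr do rewrite sum_delta.
  under eq_bigr do under eq_bigr do rewrite mulr_sumr.
  under eq_bigr do rewrite exchange_big.
  rewrite exchange_big; apply: eq_bigr => i _ /=.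
  rewrite normCK mxE rmorph_sum mulr_sumr; apply: eq_bigr => b _.
  by rewrite mulr_suml; apply: eq_bigr => b' _; rewrite !mxE rmorphM /=; ring.
- rewrite exchange_big; apply: eq_bigr => b _ /=.
  under eq_bigr do under eq_bigr do rewrite sum_delta mulr_sumr.
  under eq_bigr do rewrite exchange_big.
  rewrite exchange_big; apply: eq_bigr => k _ /=.
  rewrite normCK mxE rmorph_sum mulr_sumr; apply: eq_bigr => a _.
  by rewrite mulr_suml; apply: eq_bigr => a' _; rewrite !mxE rmorphM /=; ring.
- rewrite normCK mxtrace_mulmx_tr rmorph_sum mulr_sumr; apply: eq_bigr => a _.
  rewrite rmorph_sum mulr_sumr; apply: eq_bigr => b _.
  rewrite mulr_suml; apply: eq_bigr => a' _.
  by rewrite mulr_suml; apply: eq_bigr.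
Qed.

Lemma werner0_tens_form_le d (v w : 'cV[C]_(d * d)) : (1 < d)%N ->
  (w^t* *m tens_map (@werner0 R d) (@werner0 R d) (v *m v^t*) *m w) 0 0 <=
  (d%:R - 1)^-1 ^+ 2 * (2 - 2 / d%:R) * (\tr (v *m v^t*) * \tr (w *m w^t*)).
Proof.
move=> d1; have d0 : 0 < d%:R :> C by rewrite ltr0n ltnW.
rewrite werner0_tens_form -!sqnorm_unvec -mulrA.
have c0 : 0 <= (d%:R - 1)^-1 ^+ 2 :> C.
  by rewrite exprn_ge0 // invr_ge0 subr_ge0 ler1n ltnW.
apply: ler_wpM2l => //; move: (unvec v) (unvec w) => M N.
have := mxtrace_sqr_le (N *m M^T); have := mxtrace_sqr_le (N^T *m M).
(* N^T M and N M^T have the same trace, so one t serves in all three inequalities. *)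
rewrite mxtrace_trmul; have := mxtrace_mulmx_tr_le N M.
rewrite [sqnorm N * _]mulrC; set t := `|_| ^+ 2; set A := _ * _.
set g1 := sqnorm _; set g2 := sqnorm _ => tA tg1 tg2.
have t1 : t / d%:R <= g1 by rewrite ler_pdivrMr // mulrC.
have t2 : t / d%:R <= g2 by rewrite ler_pdivrMr // mulrC.
(* Replacing both norms by t / d leaves t with coefficient 1 - 2 / d; its sign allows t <= A to be
   applied. *)
have d2 : 0 <= 1 - 2 / d%:R :> C.
  by rewrite subr_ge0 ler_pdivrMr // mul1r ler_nat.
have tA' : (1 - 2 / d%:R) * t <= (1 - 2 / d%:R) * A by apply: ler_wpM2l.
rewrite -subr_ge0.
have -> : (2 - 2 / d%:R) * A - (A - g2 - g1 + t) =
   ((1 - 2 / d%:R) * A - (1 - 2 / d%:R) * t) + (g1 - t / d%:R) + (g2 - t / d%:R).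
  by ring.
by apply: addr_ge0; first apply: addr_ge0; rewrite subr_ge0.
Qed.

(** * The value of one copy *)

Lemma mxtrace_delta n (j k : 'I_n) : \tr (delta_mx j k : 'M[C]_n) = (j == k)%:R.
Proof.
rewrite -[RHS](sum_delta k (fun k => (j == k)%:R)); apply: eq_bigr => l _.
by rewrite mxE -natrM mulnb andbC [l == j]eq_sym [l == k]eq_sym.
Qed.

Lemma psdmx_rank1 n (v : 'cV[C]_n) : psdmx (v *m v^t*).
Proof.
have := psdmx_conj v (A := 1%:M); rewrite mulmx1; apply.
by move=> u; rewrite mulmx1 -trace_mx11 mxtrace_mulC -sqnormE sqnorm_ge0.
Qed.

Lemma density_rank1 n (a : C) (v : 'cV[C]_n) :
  0 <= a -> a * \tr (v *m v^t*) = 1 -> density (a *: (v *m v^t*)).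
Proof.
move=> a0 tr1; split; last by rewrite mxtraceZ.
by apply: psdmxZ => //; apply: psdmx_rank1.
Qed.

Lemma cv_werner0 d : (1 < d)%N -> cv (@werner0 R d) = (d%:R / (d%:R - 1) : R)%:E.
Proof.
move=> d1; have d10 : 0 < d%:R - 1 :> R by rewrite subr_gt0 ltr1n.
have cE : (((d%:R - 1)^-1 : R)%:C)%C = (d%:R - 1)^-1 :> C.
  by rewrite fmorphV rmorphB rmorph1 rmorph_nat.
apply/eqP; rewrite eq_le; apply/andP; split.
  rewrite mulrC; apply: cv_le => v w.
  rewrite werner0_form cE; apply: ler_wpM2l.
    by rewrite -cE ler0c invr_ge0 ltW.
  by rewrite gerBl exprn_ge0.
(* Indices in ['I_d.+2] form a ring with 1 != 0, so i + 1 differs from i. *)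
case: d d1 d10 cE => [//|[//|d]] d1 d10 cE.
(* Letter i is sent as basis state i + 1, which avoids the outcome i. *)
pose e (i : 'I_d.+2) : 'cV[C]_d.+2 := delta_mx i 0.
have eeE i : e i *m (e i)^t* = delta_mx i i.
  by rewrite trmx_delta map_delta_mx mul_delta_mx.
have := @cv_ge _ _ (@werner0 R d.+2) 'I_d.+2 0
  (fun i => e (i + 1) *m (e (i + 1))^t*) (fun i => e i *m (e i)^t*).
have -> : \sum_t complex.Re (\tr (e t *m (e t)^t* *m
     werner0 (e (t + 1) *m (e (t + 1))^t*))) = (d.+2%:R / (d.+2%:R - 1) : R).
  under eq_bigr => i _.
    rewrite mxtrace_rank1 werner0_form !eeE.
    have -> : e (i + 1) *m (e i)^T = delta_mx (i + 1) i.
      by rewrite trmx_delta mul_delta_mx.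
    have ne : (i + 1 == i) = false by rewrite -subr_eq0 [i + 1]addrC addrK oner_eq0.
    rewrite !mxtrace_delta ne !eqxx normr0 expr0n subr0 !mulr1 -cE /=.
    over.
  by rewrite sumr_const card_ord [RHS]mulr_natl.
apply.
- move=> i; rewrite -[_ *m _]scale1r; apply: density_rank1; rewrite ?ler01 //.
  by rewrite mul1r eeE mxtrace_delta eqxx.
- by move=> i; apply: psdmx_rank1.
- by rewrite [RHS]mx1_sum_delta; apply: eq_bigr.
Qed.

(** * Signed shifts and the value of two copies *)

Definition signed_shift d (t : {ffun 'I_d.+1 -> bool} * 'I_d.+1) : 'M[C]_d.+1 :=
  \matrix_(i, j) ((-1) ^+ t.1 i * (j == i + t.2)%:R).

Definition vec p q (G : 'M[C]_(p, q)) : 'cV[C]_(p * q) :=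
  \col_x G (mxtens_unindex x).1 (mxtens_unindex x).2.

Lemma vecK p q : cancel (@vec p q) (@unvec p q).
Proof. by move=> G; apply/matrixP => i j; rewrite !mxE mxtens_indexK. Qed.

Lemma conjC_sign (b : bool) : ((-1) ^+ b : C)^* = (-1) ^+ b.
Proof. by rewrite rmorphXn rmorphN1. Qed.

(** Row i is supported at column i + t.2 alone, so distinct rows have disjoint supports, and signs
    square to 1. *)
Lemma signed_shift_mulmx d (t : {ffun 'I_d.+1 -> bool} * 'I_d.+1) :
  signed_shift t *m (signed_shift t)^T = 1%:M.
Proof.
apply/matrixP => i j; rewrite mxE.
transitivity (\sum_k (i + t.2 == k)%:R *
    ((-1) ^+ t.1 i * (-1) ^+ t.1 j * (k == j + t.2)%:R) : C).
  by apply: eq_bigr => k _; rewrite !mxE [k == i + _]eq_sym; ring.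
rewrite sum_delta (inj_eq (addIr _)) mxE.
by case: eqVneq => [->|_]; rewrite ?mulr0 // mulr1 -expr2 sqrr_sign.
Qed.

Lemma conj_signed_shift d (t : {ffun 'I_d.+1 -> bool} * 'I_d.+1) :
  map_mx Num.conj (signed_shift t) = signed_shift t.
Proof. by apply/matrixP=> i j; rewrite !mxE rmorphM /= conjC_sign rmorph_nat. Qed.

(** For i != j, flipping the sign at i is an involution that negates the summand, so the sum equals
    its opposite. *)
Lemma sum_signs d (i j : 'I_d) :
  \sum_(f : {ffun 'I_d -> bool}) (-1) ^+ f i * (-1) ^+ f j =
    (2 ^ d)%:R * (i == j)%:R :> C.
Proof.
have [->|ne] := eqVneq i j.
  under eq_bigr do rewrite -expr2 sqrr_sign.
  by rewrite sumr_const card_ffun card_bool card_ord mulr1.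
pose flip (f : {ffun 'I_d -> bool}) := [ffun k => (k == i) (+) f k].
have flipK : involutive flip.
  by move=> f; apply/ffunP=> k; rewrite !ffunE addKb.
rewrite mulr0; set S := \sum_f _; have : S = - S.
  rewrite {1}/S (reindex_inj (inv_inj flipK)) -sumrN; apply: eq_bigr => f _ /=.
  by rewrite !ffunE eqxx [j == i]eq_sym (negPf ne) /= signrN mulNr.
by move/eqP; rewrite -addr_eq0 -mulr2n mulrn_eq0 => /eqP.
Qed.

(** Summing over signs kills the entries with i != k; for i = k only the shift a = j - i reaches
    column j, which forces l = j. *)
Lemma sum_signed_shift d :
  \sum_t vec (@signed_shift d t) *m (vec (signed_shift t))^t* = (2 ^ d.+1)%:R *: 1%:M.
Proof.
apply/matrixP=> x y; case: (mxtens_indexP x) => i j; case: (mxtens_indexP y) => k l.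
rewrite summxE -(pair_bigA _ (fun f a => (vec (signed_shift (f, a)) *m
  (vec (signed_shift (f, a)))^t*) (mxtens_index (i, j)) (mxtens_index (k, l)))) /=.
under eq_bigr do under eq_bigr do rewrite mxE big_ord1 !mxE !mxtens_indexK /=
  rmorphM /= conjC_sign rmorph_nat mulrACA.
rewrite exchange_big /=; under eq_bigr do rewrite -mulr_suml sum_signs.
rewrite -mulr_sumr !mxE (inj_eq (can_inj (@mxtens_indexK _ _))) xpair_eqE.
rewrite -mulrA; congr (_ * _); have [->|_] /= := eqVneq i k; last by rewrite mul0r.
rewrite mul1r; transitivity (\sum_a (j - k == a)%:R * (l == k + a)%:R : C).
  by apply: eq_bigr => a _; rewrite subr_eq [a + k]addrC.
by rewrite sum_delta addrC subrK eq_sym.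
Qed.

Lemma mxtrace_vec p q (G : 'M[C]_(p, q)) : \tr (vec G *m (vec G)^t*) = sqnorm G.
Proof. by rewrite -sqnorm_unvec vecK. Qed.

Lemma sqnorm_signed_shift d (t : {ffun 'I_d.+1 -> bool} * 'I_d.+1) :
  sqnorm (signed_shift t) = d.+1%:R.
Proof.
by rewrite sqnormE -map_trmx conj_signed_shift signed_shift_mulmx mxtrace1.
Qed.

Lemma sqnorm1 n : sqnorm (1%:M : 'M[C]_n) = n%:R.
Proof. by rewrite sqnormE trmx1 map_mx1 mulmx1 mxtrace1. Qed.

(** With D = d.+1 and M = N real orthogonal, the bracket of [werner0_tens_form] is D^2 - D - D + D^2
    = 2 D (D - 1). *)
Lemma werner0_tens_signed_shift d (t : {ffun 'I_d.+1 -> bool} * 'I_d.+1)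
    (v := vec (signed_shift t)) :
  (v^t* *m tens_map (@werner0 R d.+1) (@werner0 R d.+1) (v *m v^t*) *m v) 0 0 =
  d%:R^-1 ^+ 2 * (2 * d.+1%:R * d%:R).
Proof.
rewrite werner0_tens_form vecK (mulmx1C (signed_shift_mulmx t)) signed_shift_mulmx.
rewrite sqnorm_signed_shift sqnorm1 mxtrace1 ger0_norm ?ler0n //.
by rewrite -natr1 addrK; congr (_ * _); ring.
Qed.

Lemma cv_tens_werner0 d : (1 < d)%N ->
  cv (tens_map (@werner0 R d) (@werner0 R d)) = (2 * d%:R / (d%:R - 1) : R)%:E.
Proof.
move=> d1; have d10 : 0 < d%:R - 1 :> R by rewrite subr_gt0 ltr1n.
have d0 : 0 < d%:R :> R by rewrite ltr0n ltnW.
apply/eqP; rewrite eq_le; apply/andP; split.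
  have -> : 2 * d%:R / (d%:R - 1) =
      ((d%:R - 1)^-1 ^+ 2 * (2 - 2 / d%:R)) * (d * d)%:R :> R.
    by rewrite natrM; field; rewrite (gt_eqF d0) (gt_eqF d10).
  apply: cv_le => v w; apply: le_trans (werner0_tens_form_le _ _ d1) _.
  by rewrite !(rmorphM, rmorphXn, fmorphV, rmorphB, rmorph1, rmorph_nat).
case: d d1 d10 d0 => [//|d] d1 d10 d0.
have dn0 : d%:R != 0 :> R by rewrite pnatr_eq0 -lt0n.
pose v t := vec (@signed_shift d t).
(* States and effects are the same rank-one matrices: with D = d.+1, the factor 1 / D gives trace 1
   and 2^-D makes the effects sum to the identity. *)
have := @cv_ge _ _ (tens_map (@werner0 R d.+1) (@werner0 R d.+1))
  ({ffun 'I_d.+1 -> bool} * 'I_d.+1)%type ([ffun=> false], 0)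
  (fun t => d.+1%:R^-1 *: (v t *m (v t)^t*))
  (fun t => (2 ^ d.+1)%:R^-1 *: (v t *m (v t)^t*)).
have p0 : (2 ^ d.+1)%:R != 0 :> R by rewrite pnatr_eq0 expn_eq0.
have -> : \sum_t complex.Re (\tr ((2 ^ d.+1)%:R^-1 *: (v t *m (v t)^t*) *m
     tens_map (@werner0 R d.+1) (@werner0 R d.+1)
       (d.+1%:R^-1 *: (v t *m (v t)^t*)))) =
     (2 * d.+1%:R / (d.+1%:R - 1) : R).
  under eq_bigr => t _.
    rewrite linearZ /= -scalemxAr -scalemxAl !mxtraceZ mxtrace_rank1.
    rewrite werner0_tens_signed_shift.
    have -> : d.+1%:R^-1 * ((2 ^ d.+1)%:R^-1 * (d%:R^-1 ^+ 2 * (2 * d.+1%:R * d%:R))) =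
       (((2 ^ d.+1)%:R^-1 * (2 / d%:R) : R)%:C)%C.
      rewrite !(rmorphM, fmorphV, rmorph_nat).
      field.
      by rewrite nat1r !pnatr_eq0 expn_eq0 -lt0n andbT.
    over.
  (* There are 2^D D outcomes, each contributing 2^-D * 2 / (D - 1). *)
  rewrite sumr_const card_prod card_ffun card_bool card_ord.
  rewrite -[LHS]mulr_natr natrM -[d.+1%:R]natr1 addrK.
  move: (2 ^ d.+1)%N p0 => n n0 /=.
  by field; rewrite dn0 n0.
apply.
- move=> t; apply: density_rank1; rewrite ?invr_ge0 ?ler0n //.
  by rewrite mxtrace_vec sqnorm_signed_shift mulVf // pnatr_eq0.
- by move=> t; apply: psdmxZ (psdmx_rank1 _); rewrite invr_ge0 ler0n.
- by rewrite -scaler_sumr sum_signed_shift scalerA mulVf ?scale1r //.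
Qed.

End CommunicationValue.

Theorem mainTheorem8 (R : realType) (d : nat) (hd : (2 <= d)%N) :
  [/\ cv (@werner0 R d) = (d%:R / (d%:R - 1) : R)%:E,
      cv (tens_map (@werner0 R d) (@werner0 R d))
        = (2 * d%:R / (d%:R - 1) : R)%:E &
      (3 <= d)%N ->
      (cv (@werner0 R d) ^+ 2
         < cv (tens_map (@werner0 R d) (@werner0 R d)))%E].
Proof.
split; [exact: cv_werner0|exact: cv_tens_werner0|move=> d3].
rewrite cv_werner0 // cv_tens_werner0 // -EFin_expe lte_fin expr2.
have d10 : 0 < d%:R - 1 :> R by rewrite subr_gt0 ltr1n.
have d0 : 0 < d%:R :> R by rewrite ltr0n ltnW.
(* Cancelling d / (d - 1) leaves d / (d - 1) < 2, that is d > 2. *)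
rewrite mulrA ltr_pM2r ?invr_gt0 // mulrAC [2 * _]mulrC -mulrA ltr_pM2l //.
rewrite ltr_pdivrMr //.
have : (3%:R <= d%:R :> R) by rewrite ler_nat.
lra.
Qed.
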